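(* Let $G$ be a finite group, let $G=AB$ be the product of the subgroups $A$ and $B$, let $p\in\pi(G)$, and suppose that $G=AB$ is a $p$-Baer factorisation. Let $P$ be a Sylow $p$-subgroup of $G$. Then: (1) $G/C_G(O_p(G))$ is $p$-decomposable. (2) Both $PF(G)$ and $PO_{p'}(G)$ are normal in $G$. In particular, $G$ is $p$-soluble of $p$-length $1$. (3) The Sylow $p$-subgroup of $G/F(G)$ is abelian. (4) $P$ is abelian if and only if $O_p(G)$ is abelian. (5) If $P=(P\cap A)(P\cap B)$ and $P\cap X\not\leqslant C_G(O_p(G))$ for some $X\in\{A,B\}$, then $P\cap X$ centralises every Hall $p'$-subgroup of $G$. (6) If the Sylow $p$-subgroups of $A$ and of $B$ are non-abelian, then $G$ is $p$-decomposable.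
   Context: All groups are finite. $\pi(G)$ is the set of prime divisors of $|G|$. For $x\in G$, the index of $x$ in $G$ is $i_G(x)=|G:C_G(x)|$, the size of the conjugacy class of $x$. The number $1$ is regarded as a power of every prime. ''$G=AB$ is the product of the subgroups $A$ and $B$'' means that $G=\{ab : a\in A, b\in B\}$. For $p\in\pi(G)$, $G=AB$ is a $p$-Baer factorisation if $i_G(x)$ is a prime power for every $p$-element $x\in A\cup B$ (the prime may depend on $x$). $F(G)$ is the Fitting subgroup of $G$; $O_\pi(G)$ is the largest normal $\pi$-subgroup of $G$; $p'$ denotes the set of primes different from $p$. A group $G$ is $p$-decomposable if $G=O_p(G)\times O_{p'}(G)$. *)

(* Defs.v *)
From mathcomp Require Import all_boot all_fingroup all_solvable.
Set Implicit Arguments.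
Unset Strict Implicit.
Unset Printing Implicit Defensive.
Import GroupScope.

Section PBaer.

Variable gT : finGroupType.
Implicit Types (p : nat) (G A B : {group gT}) (x : gT).

Definition cl_index G x : nat := #|G : 'C_G[x]|.

(* The exponent may be 0, so 1 is a prime power. *)
Definition prime_power (n : nat) : Prop :=
  exists q k : nat, prime q /\ n = (q ^ k)%N.

Definition p_baer_factorisation p G A B : Prop :=
  [/\ p \in \pi(G), A * B = G
    & forall x, x \in A :|: B -> p.-elt x -> prime_power (cl_index G x)].

Definition p_decomposable p (hT : finGroupType) (H : {group hT}) : Prop :=
  'O_p(H) \x 'O_p^'(H) = H.

(* In chief_factor G V U the factor is U / V. *)
Definition p_soluble p G : Prop :=
  forall U V : {group gT}, chief_factor G V U ->
    p.-group (U / V) \/ p^'.-group (U / V).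

(* The term of the upper p'p-series 1 <= O_{p'}(G) <= O_{p',p}(G) <= ...
   ending with p' and in which p occurs n times. *)
Definition upper_p'p p n G : {set gT} :=
  pseries (p^' :: flatten (nseq n [:: (p : nat_pred); p^'])) G.

Definition p_length_eq p G n : Prop :=
  upper_p'p p n G = G /\ forall m, (m < n)%N -> upper_p'p p m G <> G.

End PBaer.

(* Main.v *)
Require Import Defs.
From mathcomp Require Import all_boot all_fingroup all_solvable.
From mathcomp Require Import all_order all_algebra all_field all_character.
From mathcomp Require Import zify.
Set Implicit Arguments.
Unset Strict Implicit.
Unset Printing Implicit Defensive.
Import Order.TTheory GRing.Theory Num.Theory.
Import GroupScope.

(* A p-element x of index a power of a prime q lies in 'O_p(G) if q = p (Wielandt). If q <> p,
   it lies in 'O_{q,p}(G): by induction one may assume that G is generated by x and L = [G, <x>],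
   and it suffices to show that p does not divide #|L|, for then x normalises a Sylow q-subgroup Q
   of L, and G = 'C_G[x] * Q gives L <= Q. Let omega_i = #|x ^: G| chi_i(x) / chi_i(1). If p
   divides #|L|, choose w in L of order p. A p-adic limit of the numbers of ways of writing w as a
   product of m conjugates of x shows that the sum of chi_i(1) chi_i(w^-1) over all i such that
   omega_i is a unit at a given prime above p vanishes. In this sum the i with L <= ker chi_i
   contribute #|G : L|, a power of p. For the others chi_i(x) <> 0, so Burnside's argument
   shows that q divides chi_i(1). Hence q divides #|G : L|, a contradiction.

   In a p-Baer factorisation, some Sylow subgroup P = (P :&: A) * (P :&: B) is thus generated by
   elements of 'O_p(G) of p-power index and by elements of 'O_{q,p}(G), q <> p, which are central in
   some Sylow p-subgroup; all the claims follow. *)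

(** * Congruences between algebraic integers *)

Section AlgebraicIntegers.
Local Open Scope ring_scope.

Lemma eqAmod_natP (d : nat) (x y : algC) : (0 < d)%N ->
  reflect (exists2 c, c \in Aint & x = y + c * d%:R) (x == y %[mod d])%A.
Proof.
move=> d_gt0; have nz_d : d%:R != 0 :> algC by rewrite pnatr_eq0 -lt0n.
rewrite /eqAmod unfold_in (negPf nz_d); apply: (iffP idP) => [Zxy | [c Zc ->]].
  by exists ((x - y) / d%:R); rewrite // divfK // addrC subrK.
by rewrite addrC addKr mulfK.
Qed.

Lemma eqAmodX (d k : nat) (x y : algC) : x \in Aint -> y \in Aint ->
  (x == y %[mod d])%A -> (x ^+ k == y ^+ k %[mod d])%A.
Proof.
move=> Zx Zy xy; elim: k => [|k IHk]; first by rewrite !expr0.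
by rewrite !exprS eqAmodM // rpredX.
Qed.

Lemma eqAmod_dvd (d e : nat) (x y : algC) : (0 < e)%N -> (d %| e)%N ->
  (x == y %[mod e])%A -> (x == y %[mod d])%A.
Proof.
move=> e_gt0 /dvdnP[k def_e] /(eqAmod_natP _ _ e_gt0)[c Zc ->].
have d_gt0 : (0 < d)%N by move: e_gt0; rewrite def_e; case: (d) => //; rewrite muln0.
apply/eqAmod_natP => //; exists (c * k%:R); first by rewrite rpredM ?rpred_nat.
by rewrite def_e natrM mulrA.
Qed.

(** [x ^+ p - y ^+ p] is [x - y] times a sum of [p] monomials, each congruent to [y ^+ p.-1] modulo
    [p]; this sum supplies the extra factor [p]. *)
Lemma eqAmod_expp_step (p k : nat) (x y : algC) :
    (0 < p)%N -> x \in Aint -> y \in Aint ->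
  (x == y %[mod (p ^ k.+1)%N])%A -> (x ^+ p == y ^+ p %[mod (p ^ k.+2)%N])%A.
Proof.
move=> p_gt0 Zx Zy exy; have pk_gt0 j : (0 < p ^ j)%N by rewrite expn_gt0 p_gt0.
have exy1 : (x == y %[mod p])%A.
  by apply: eqAmod_dvd exy; rewrite ?pk_gt0 // expnS dvdn_mulr.
have [c Zc Dx] := eqAmod_natP _ _ (pk_gt0 _) exy.
have: (\sum_(i < p) x ^+ (p.-1 - i) * y ^+ i == 0 %[mod p])%A.
  apply: (@eqAmod_trans _ (\sum_(i < p) y ^+ p.-1)).
    rewrite /eqAmod -sumrB rpred_sum // => i _.
    have -> : y ^+ p.-1 = y ^+ (p.-1 - i) * y ^+ i.
      by rewrite -exprD subnK // -ltnS prednK.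
    by apply: eqAmodMr; rewrite ?rpredX ?eqAmodX.
  rewrite sumr_const card_ord -mulr_natr; exact: eqAmodMl0 (rpredX _ _).
case/(eqAmod_natP _ _ p_gt0) => d Zd; rewrite add0r => Ds.
apply/eqAmod_natP=> //; exists (c * d); first exact: rpredM.
apply/eqP; rewrite addrC -subr_eq subrXX Ds Dx addrC addKr.
by rewrite mulrACA -natrM -expnSr.
Qed.

Lemma eqAmod_expp (p n : nat) (x y : algC) :
    (0 < p)%N -> x \in Aint -> y \in Aint -> (x == y %[mod p])%A ->
  (x ^+ (p ^ n) == y ^+ (p ^ n) %[mod (p ^ n.+1)%N])%A.
Proof.
move=> p_gt0 Zx Zy exy; elim: n => [|n IHn]; first by rewrite !expr1 expn1.
by rewrite (expnSr p n) !exprM eqAmod_expp_step ?rpredX.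
Qed.

(** [x] lies in a ring spanned by finitely many algebraic integers, hence finite modulo [p]; so the
    powers of [x] are eventually periodic modulo [p]. *)
Lemma Aint_exp_idem (p : nat) (x : algC) : (0 < p)%N -> x \in Aint ->
  exists2 m, (0 < m)%N & (x ^+ m * x ^+ m == x ^+ m %[mod p])%A.
Proof.
move=> p_gt0 Zx; have [|S [ringS SX [[n Y] /= SY YP]]] := @Aint_subring_exists [:: x].
  by apply/allP; rewrite /= Zx.
have [S1 SB SM] := ringS.
have sSZ : {subset S <= Aint} by apply: fin_Csubring_Aint YP.
have Sx i : x ^+ i \in S.
  elim: i => [|i IHi]; first by rewrite expr0.
  by rewrite exprS SM // SX ?mem_head.
pose c i := sval (sig_eqW (YP _ (Sx i))).
have Dx i : x ^+ i = \sum_(j < n) Y`_j *~ c i j by rewrite /c; case: sig_eqW.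
have [q Dp] : exists q, p = q.+1 by exists p.-1; rewrite prednK.
pose f (i : nat) : {ffun 'I_n -> 'I_q.+1} :=
  [ffun j => inord `|(c i j %% p%:Z)%Z|].
have [i [j [lt_ij eq_f]]] : exists i j, (i < j)%N /\ f i = f j.
  have: ~~ injectiveb (fun i : 'I_(#|{ffun 'I_n -> 'I_p}|.+1) => f i).
    by apply/injectiveP => /leq_card; rewrite card_ord Dp ltnn.
  case/injectivePn => i [j ne_ij eq_f]; have [lt_ij|lt_ji|] := ltngtP i j.
  - by exists (i : nat), (j : nat).
  - by exists (j : nat), (i : nat).
  by move/val_inj => eq_ij; rewrite eq_ij eqxx in ne_ij.
have exx : (x ^+ i == x ^+ j %[mod p])%A.
  rewrite /eqAmod !Dx -sumrB rpred_sum // => k _; rewrite -mulrzBr.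
  have /ffunP/(_ k) := eq_f; rewrite !ffunE => /(congr1 val)/=.
  have ltp z : (`|(z %% p%:Z)%Z| < q.+1)%N.
    by rewrite -Dp -ltz_nat gez0_abs ?modz_ge0 ?ltz_mod //; lia.
  rewrite !inordK // => eqc.
  have /dvdzP[d ->] : (p%:Z %| c i k - c j k)%Z.
    rewrite -eqz_mod_dvd; apply/eqP; have := congr1 Posz eqc.
    by rewrite !gez0_abs ?modz_ge0 //; lia.
  rewrite -eqAmod0; apply/eqAmod_natP => //; exists (Y`_k *~ d).
    by rewrite rpredMz // sSZ // SY // mem_nth // size_tuple.
  by rewrite add0r mulrzA mulr_natr.
pose d := (j - i)%N; have d_gt0 : (0 < d)%N by rewrite subn_gt0.
have step k l : (i <= k)%N -> (x ^+ (k + l * d) == x ^+ k %[mod p])%A.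
  move=> le_ik; elim: l => [|l IHl]; first by rewrite addn0.
  apply: eqAmod_trans IHl; rewrite mulSn addnCA.
  have -> : (d + (k + l * d) = j + (k - i + l * d))%N by rewrite /d; lia.
  have -> : (k + l * d = i + (k - i + l * d))%N by lia.
  by rewrite (exprD x j) (exprD x i); apply: eqAmodMr; rewrite ?rpredX // eqAmod_sym.
(* A multiple of the period [d], not below the preperiod [i]; [i.+1] keeps it positive when
   [i = 0]. *)
exists (i.+1 * d)%N; first by rewrite muln_gt0.
by rewrite -exprD step //; nia.
Qed.

(** [x] divides the constant term of its minimal polynomial, which is non-zero, as otherwise ['X]
    would divide this polynomial. *)
Lemma Aint_dvd_nat (x : algC) : x \in Aint -> x != 0 ->
  exists y (s : nat), [/\ y \in Aint, (0 < s)%N & y * x = s%:R].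
Proof.
move=> Zx nz_x; have [p [Dp mon_p] dvp] := minCpolyP x.
have nz_p0 : p`_0 != 0.
  apply: contra nz_x => p0.
  have /factor_theorem[q Dq] : root p 0 by rewrite /root horner_coef0.
  rewrite subr0 in Dq.
  have: root (minCpoly x) x by exact: root_minCpoly.
  rewrite Dp Dq rmorphM /= map_polyX rootM => /orP[|]; last by rewrite rootX.
  rewrite dvp => /dvdp_leq; rewrite Dq.
  have [q0 | nz_q] := eqVneq q 0; first by move: (monic_neq0 mon_p); rewrite Dq q0 mul0r eqxx.
  by rewrite size_mulX // ltnn => /(_ isT).
have Zp : minCpoly x \is a polyOver Num.int by [].
have /intrP[c Dc] : (minCpoly x)`_0 \in Num.int by apply/polyOverP.
have nz_c : c != 0.
  by apply: contra nz_p0 => /eqP c0; move: Dc; rewrite c0 Dp coef_map => /eqP; rewrite fmorph_eq0.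
pose r := \poly_(i < (size (minCpoly x)).-1) (minCpoly x)`_i.+1.
have Zr : r.[x] \in Aint.
  rewrite horner_poly rpred_sum // => i _; rewrite rpredM ?rpredX //.
  by apply: Aint_Cint; apply/polyOverP.
have Drx : r.[x] * x = - c%:~R.
  have /rootP := root_minCpoly x; rewrite horner_coef.
  rewrite -[size _]prednK ?(ltnW (size_minCpoly x)) // big_ord_recl expr0 mulr1 Dc.
  move/eqP; rewrite addrC addr_eq0 => /eqP <-; rewrite horner_poly mulr_suml.
  by apply: eq_bigr => i _; rewrite exprSr mulrA.
exists (r.[x] * - (Num.sg c)%:~R), `|c|%N; split; last 1 first.
- by rewrite mulrAC Drx mulrNN -rmorphM /= mulrC -normrEsg -abszE pmulrn.
- by rewrite rpredM // rpredN Aint_int.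
by rewrite absz_gt0.
Qed.

End AlgebraicIntegers.

(** * Counting products of conjugates *)

Section TupleProducts.

Variable gT : finGroupType.
Implicit Types (s : seq gT) (K C : {set gT}) (H : {group gT}).

(** [s2] starts with [s1], and what remains still commutes with [s1]; so [s2] consists of [k] copies
    of [s1]. *)
Lemma prod_periodic s1 s2 k : s1 ++ s2 = s2 ++ s1 -> size s2 = (k * size s1)%N ->
  \prod_(x <- s2) x = (\prod_(x <- s1) x) ^+ k.
Proof.
elim: k s2 => [|k IHk] s2 eq12 sz2.
  by rewrite (size0nil sz2) big_nil expg0.
have Ds2 : s2 = s1 ++ drop (size s1) s2.
  rewrite -{1}(cat_take_drop (size s1) s2); congr (_ ++ _).
  have le12 : size s1 <= size s2 by rewrite sz2 mulSn leq_addr.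
  by rewrite -(takel_cat s1 le12) -eq12 take_size_cat.
rewrite {1}Ds2 big_cat /= expgS (IHk (drop (size s1) s2)) //; last first.
  by rewrite size_drop sz2 mulSn addKn.
move: eq12; rewrite {1 2}Ds2 -catA => /eqP; rewrite eqseq_cat // eqxx /=.
by move=> /eqP <-.
Qed.

Lemma prod_mem H K s : K \subset H -> all [in K] s -> \prod_(x <- s) x \in H.
Proof.
move=> sKH /allP sK; rewrite big_seq; apply: group_prod => x /sK.
exact: subsetP.
Qed.

Definition class_tuples m K C :=
  [set t : m.-tuple gT | all [in K] t & \prod_(x <- t) x \in C].

Lemma iter_rot (T : Type) (s : seq T) d k : (k * d <= size s)%N ->
  iter k (seq.rot d) s = seq.rot (k * d) s.
Proof.
elim: k => [|k IHk] le_kd; first by rewrite rot0.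
rewrite iterS IHk; first by rewrite mulSn rotD // -mulSn.
by apply: leq_trans le_kd; rewrite mulSn leq_addl.
Qed.

(* Rotations by d permute these tuples. A tuple in an orbit of size p ^ j has product
   v ^+ (p ^ (n - j)) for some v, so j >= n - c. *)
Lemma dvdn_class_tuples H K C p c d n : prime p -> K \subset H ->
    (forall h g, h \in H -> g \in C -> g ^ h \in C) ->
    (forall g, g \in H -> g ^+ (p ^ c) \notin C) ->
  (p ^ (n - c) %| #|class_tuples (p ^ n * d) K C|)%N.
Proof.
move=> p_pr sKH CJ notCX; set X := class_tuples _ K C.
pose r (t : (p ^ n * d).-tuple gT) := rot_tuple d t.
have r_inj : injective r by move=> t u /(congr1 val)/rot_inj/val_inj.
pose a := perm r_inj.
have aE k t : (k <= p ^ n)%N -> val ((a ^+ k) t) = seq.rot (k * d) t.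
  move=> le_k; rewrite -iter_rot ?size_tuple ?leq_mul2r ?le_k ?orbT // {le_k}permX.
  by elim: k => //= k <-; rewrite permE.
have a1 : a ^+ (p ^ n) = 1.
  apply/permP=> t; rewrite perm1; apply/val_inj; rewrite aE //.
  by rewrite rot_oversize ?size_tuple.
have actsX : [acts <[a]>, on X | 'P].
  rewrite cycle_subG; apply/astabsP => t; rewrite /= apermE permE.
  rewrite !inE /r /= (eq_all_r (mem_rot d t)); case Kt: (all _ t) => //=.
  have Kd : all [in K] (take d t).
    by move: Kt; rewrite -{1}(cat_take_drop d t) all_cat => /andP[].
  have Hd := prod_mem sKH Kd.
  (* Rotation conjugates the product by the product of the first [d] entries. *)
  have Dt : \prod_(x <- seq.rot d t) x = (\prod_(x <- t) x) ^ (\prod_(x <- take d t) x).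
    rewrite -[in X in X ^ _](cat_take_drop d t) /seq.rot !big_cat /=.
    by rewrite conjgE !mulgA mulVg mul1g.
  rewrite Dt; apply/idP/idP=> [Cv|]; last exact: CJ.
  by rewrite -[\prod_(x <- t) x](conjgK (\prod_(x <- take d t) x)) CJ ?groupV.
rewrite (card_partition (orbit_partition actsX)) dvdn_sum // => _ /imsetP[t Xt ->].
have [j le_jn Dj] : exists2 j, (j <= n)%N & #|orbit 'P <[a]> t| = (p ^ j)%N.
  apply/dvdn_pfactor => //; apply: dvdn_trans (_ : #[a] %| _)%N.
    by rewrite card_orbit dvdn_indexg.
  by rewrite order_dvdn a1.
rewrite Dj; have [le_nc | lt_jnc] := leqP (n - c) j; first exact: dvdn_exp2l.
have Dpj : #|porbit a t| = (p ^ j)%N by rewrite porbit.unlock.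
have fixt : seq.rot (p ^ j * d) t = t.
  by rewrite -aE ?leq_exp2l ?prime_gt1 // permX -Dpj iter_porbit.
have [/= Kt Ct] := setIdP Xt; set e := (p ^ j * d)%N in fixt.
have le_en : (e <= size t)%N.
  by rewrite size_tuple leq_mul2r leq_exp2l ?prime_gt1 // le_jn orbT.
have Dn : (p ^ n * d = p ^ (n - j) * e)%N.
  by rewrite /e mulnA -expnD subnK.
have: \prod_(x <- t) x = (\prod_(x <- take e t) x) ^+ (p ^ (n - j)).
  apply: prod_periodic; last by rewrite size_takel // size_tuple Dn.
  by rewrite -{2}fixt catA cat_take_drop.
move=> Dt; set v := \prod_(x <- take e t) x in Dt.
have Hv : v \in H.
  by move: Kt; rewrite -(cat_take_drop e t) all_cat => /andP[/(prod_mem sKH)].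
have /negP[] : (v ^+ (p ^ (n - j - c))) ^+ (p ^ c) \notin C by rewrite notCX ?groupX.
by rewrite -expgM -expnD subnK -?Dt //; lia.
Qed.

End TupleProducts.

(** * Central characters and the Frobenius formula *)

Section CentralCharacters.

Variables (gT : finGroupType) (G : {group gT}).
Local Open Scope ring_scope.

(** The value of the central character [omega_i] at the class sum of [x]. *)
Definition central_char (i : Iirr G) x : algC :=
  #|x ^: G|%:R * 'chi_i x / 'chi_i 1%g.

(** By Schur's lemma the class sum of [x] acts as the scalar [central_char i x] in ['Chi_i]; take
    traces after multiplying by ['Chi_i g]. *)
Lemma sum_irr_mul_class i x g : x \in G -> g \in G ->
  \sum_(k in x ^: G) 'chi_i (g * k)%g = central_char i x * 'chi_i g.
Proof.
move=> Gx Gg; have clG := mem_classes Gx; pose k := enum_rank_in clG (x ^: G).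
have Dk : enum_val k = x ^: G by rewrite enum_rankK_in.
have sKG := subsetP (class_subG Gx (subxx G)).
rewrite /central_char -(@gring_mode_class_sum_eq _ _ i k); last by rewrite Dk class_refl.
have Zk := gring_class_sum_central algC k.
have := irr_gring_center i Zk; set om := 'omega_i[_] => Dom.
have: \sum_(y in x ^: G) 'Chi_i y = om%:M.
  rewrite -Dom /gring_class_sum Dk /gset_mx linear_sum /=; apply: eq_bigr => y /sKG Gy.
  by rewrite gring_opG.
move/(congr1 (mulmx ('Chi_i g)))/(congr1 mxtrace).
rewrite mulmx_sumr raddf_sum mul_mx_scalar mxtraceZ /= -irrRepr cfunE Gg mulr1n => <-.
apply: eq_bigr => y /sKG Gy; rewrite cfunE groupM // mulr1n repr_mxM //.
Qed.

(** Induction on [m], splitting off the first factor; the case [m = 0] is the formula for the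
    regular character. *)
Lemma card_class_tuples m x g : x \in G -> g \in G ->
  (#|class_tuples m (x ^: G) [set g]| * #|G|)%:R
    = \sum_i 'chi[G]_i 1%g * central_char i x ^+ m * 'chi_i (g^-1)%g.
Proof.
move=> Gx; have sKG := subsetP (class_subG Gx (subxx G)).
elim: m g => [|m IHm] g Gg.
  transitivity (cfReg G g^-1%g); last first.
    rewrite cfReg_sum sum_cfunE; apply: eq_bigr => i _.
    by rewrite cfunE expr0 mulr1.
  rewrite cfRegE eq_invg1 -mulrnA mulnC; congr (_ * _)%:R.
  case: eqP => [->|ntg].
    rewrite (_ : class_tuples _ _ _ = [set [tuple]]) ?cards1 //.
    by apply/setP=> t; rewrite !inE tuple0 /= big_nil !eqxx.
  rewrite (_ : class_tuples _ _ _ = set0) ?cards0 //.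
  by apply/setP=> t; rewrite !inE tuple0 /= big_nil eq_sym; apply/eqP.
have cons_inj k : injective (fun t : m.-tuple gT => [tuple of k :: t]).
  by move=> t u /(congr1 val)[] /val_inj.
have -> : #|class_tuples m.+1 (x ^: G) [set g]|
    = (\sum_(k in x ^: G) #|class_tuples m (x ^: G) [set (k^-1 * g)%g]|)%N.
  rewrite -sum1_card (partition_big (@thead m gT) [in x ^: G]) /=; last first.
    by move=> t; rewrite inE; case/tupleP: t => k t /= /andP[/andP[]]; rewrite theadE.
  apply: eq_bigr => k Kk; rewrite sum1dep_card -(card_imset _ (cons_inj k)).
  apply: eq_card => t; apply/idP/imsetP => [|[u]].
    rewrite inE; case/tupleP: t => k' t /= /andP[]; rewrite theadE => + /eqP Dk.
    rewrite !inE /= big_cons Dk => /andP[/andP[_ Kt] /eqP Dg]; exists t => //.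
    by rewrite !inE Kt -Dg mulKg eqxx.
  rewrite !inE => /andP[Ku /eqP Dk] ->; rewrite /= Kk Ku big_cons Dk.
  by rewrite mulKVg theadE !eqxx.
rewrite big_distrl /= natr_sum.
have IH k : k \in x ^: G -> (#|class_tuples m (x ^: G) [set (k^-1 * g)%g]| * #|G|)%:R
    = \sum_i 'chi[G]_i 1%g * central_char i x ^+ m * 'chi_i (g^-1 * k)%g.
  move=> Kk; rewrite IHm ?groupM ?groupV ?(sKG k) //.
  by apply: eq_bigr => i _; rewrite invMg invgK.
rewrite (eq_bigr _ IH) exchange_big /=; apply: eq_bigr => i _.
by rewrite -mulr_sumr sum_irr_mul_class ?groupV // exprSr !mulrA.
Qed.

Lemma Aint_central_char i x : x \in G -> central_char i x \in Aint.
Proof. exact: Aint_class_div_irr1. Qed.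

End CentralCharacters.

(** * From power sum congruences to a vanishing sum *)

Section PadicLimit.
Local Open Scope ring_scope.

Lemma eqAmod0_coprime (p s : nat) (x : algC) : (0 < p)%N -> coprime s p -> x \in Aint ->
  (x * s%:R == 0 %[mod p])%A -> (x == 0 %[mod p])%A.
Proof.
move=> p_gt0 co_sp Zx xs0; have [s0|s_gt0] := posnP s; last first.
  case: (egcdnP p s_gt0) => u v Duv _; rewrite (eqnP co_sp) in Duv.
  have -> : x = u%:R * (x * s%:R) - v%:R * x * p%:R.
    by rewrite mulrCA -natrM Duv natrD natrM mulrDr mulr1 mulrCA mulrA addrAC subrr add0r.
  rewrite -[X in (_ == X %[mod _])%A](subr0 0); apply: eqAmodD.
    by rewrite -[0](mulr0 u%:R); apply: eqAmodMl; rewrite ?rpred_nat.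
  by rewrite eqAmodN !oppr0; apply: eqAmodMl0; rewrite rpredM ?rpred_nat.
move: co_sp; rewrite s0 /coprime gcd0n => /eqP->.
by apply/eqAmod_natP => //; exists x; rewrite ?add0r ?mulr1.
Qed.

Variables (I : finType) (p c : nat) (a om : I -> algC).
Hypotheses (p_pr : prime p) (Za : forall i, a i \in Aint) (Zom : forall i, om i \in Aint).
Hypothesis power_sum0 : forall d n,
  (\sum_i a i * om i ^+ (p ^ n * d) == 0 %[mod (p ^ (n - c))%N])%A.

(* B consists of the i for which om i is a unit at a suitable prime above p. To avoid prime ideals
   and residue fields, B is taken maximal such that the product over B of the e i, powers of the
   om i that are idempotent modulo p, is non-zero modulo p. *)
Lemma padic_unit_sum0 : exists B : {set I},
  [/\ {in B, forall i, om i != 0},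
      forall i b (s : nat), b \in Aint -> ~~ (p %| s)%N -> b * om i = s%:R -> i \in B
    & \sum_(i in B) a i = 0].
Proof.
have p_gt0 := prime_gt0 p_pr.
have [m Hm] := fin_all_exists2 (fun i => Aint_exp_idem p_gt0 (Zom i)).
(* [d] is a common multiple of the [m i], so that all [e i] are idempotent modulo [p]. *)
move=> idem; pose d := (\prod_i m i)%N; pose e i := om i ^+ d.
have d_gt0 : (0 < d)%N by rewrite prodn_gt0.
have Ze i : e i \in Aint by rewrite rpredX.
have ee i : (e i * e i == e i %[mod p])%A.
  rewrite /e /d (bigD1 i) //= exprM -exprMn.
  by apply: eqAmodX; rewrite ?rpredM ?rpredX.
pose E (B : {set I}) := \prod_(i in B) e i.
have ZE B : E B \in Aint by rewrite rpred_prod.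
have EE B : (E B * E B == E B %[mod p])%A.
  pose idemp z := z \in Aint /\ (z * z == z %[mod p])%A.
  suffices [] : idemp (E B) by [].
  apply: (big_ind idemp) => [|x y [Zx xx] [Zy yy]|i _]; rewrite /idemp ?mul1r //.
  by rewrite mulrACA rpredM //; split=> //; apply: eqAmodM; rewrite ?rpredM.
have [B] : {B | maxset [pred B | ~~ (E B == 0 %[mod p])%A] B}.
  apply: ex_maxset; exists set0; rewrite /= /E big_set0.
  by have := eqAmod0_nat p 1; rewrite dvdn1 gtn_eqF ?prime_gt1 // => ->.
case/maxsetP => /= nzE maxB.
(* Modulo [p], [E B] absorbs [e i] for [i] in [B] and, by maximality of [B], annihilates the other
   [e i]. *)
have EinB i : i \in B -> (E B * e i == E B %[mod p])%A.
  move=> Bi; rewrite /E (bigD1 i) //= mulrAC.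
  by apply: eqAmodMr; rewrite ?rpred_prod.
have EnotB i : i \notin B -> (E B * e i == 0 %[mod p])%A.
  move=> notBi; apply: contraR (notBi) => nzEi.
  have <- : i |: B = B.
    apply: maxB; last exact: subsetUr.
    by rewrite /= /E big_setU1 //= mulrC.
  exact: setU11.
exists B; split=> [i Bi | i b s Zb p's Db | ].
- apply: contra nzE => /eqP omi0.
  by rewrite /E (bigD1 i) //= /e omi0 expr0n gtn_eqF // mul0r.
- apply: contraR nzE => /EnotB Ei0.
  apply: (@eqAmod0_coprime _ (s ^ d)) => //.
    by rewrite coprimeXl // coprime_sym prime_coprime.
  rewrite natrX -Db exprMn [b ^+ d * _]mulrC mulrA -[0](mul0r (b ^+ d)).
  by apply: eqAmodMr; rewrite ?rpredX.
apply/eqP; apply: contraR nzE => nzS; set S := \sum_(i in B) a i in nzS.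
have ZS : S \in Aint by apply: rpred_sum.
(* A non-zero [S] divides some [s = s' * p ^ k] with [s'] prime to [p]. The choice [n - c = k.+1]
   makes the power sums vanish modulo a higher power of [p] than divides [s], which forces [E B] to
   vanish modulo [p]. *)
have [y [s [Zy s_gt0 Ds]]] := Aint_dvd_nat ZS nzS.
have [s' co_ps' Ds'] := pfactor_coprime p_pr s_gt0; set k := logn p s in Ds'.
pose n := (c + k.+1)%N.
have EX j : (0 < j)%N -> (E B ^+ j == E B %[mod p])%A.
  elim: j => // -[|j] IHj _; first by rewrite expr1.
  rewrite exprS; apply: eqAmod_trans (EE B).
  by apply: eqAmodMl; rewrite ?IHj.
rewrite -(eqAmod_transl _ (EX (p ^ n)%N _)) ?expn_gt0 ?p_gt0 //.
apply: (@eqAmod0_coprime _ s'); rewrite ?rpredX // 1?coprime_sym //.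
(* The [p ^ n]-th powers of the congruences for [E B * e i] hold modulo [p ^ n.+1], so the sum over
   [B] may be replaced by the full power sum. *)
have ES : (E B ^+ (p ^ n) * S == 0 %[mod (p ^ k.+1)%N])%A.
  apply: (@eqAmod_trans _ (E B ^+ (p ^ n) * \sum_i a i * om i ^+ (p ^ n * d))); last first.
    rewrite -[X in (_ == X %[mod _])%A](mulr0 (E B ^+ (p ^ n))).
    apply: eqAmodMl; rewrite ?rpredX //.
    have Dnc : (n - c)%N = k.+1 by rewrite addKn.
    by have := power_sum0 d n; rewrite Dnc.
  rewrite /S big_mkcond !mulr_sumr /eqAmod -sumrB rpred_sum // => i _.
  rewrite [(p ^ n * d)%N]mulnC exprM -/(e i) mulrCA -exprMn.
  have pk_dv : (p ^ k.+1 %| p ^ n.+1)%N by rewrite dvdn_exp2l // /n; lia.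
  have pn_gt0 : (0 < p ^ n.+1)%N by rewrite expn_gt0 p_gt0.
  case: ifP => [Bi | /negbT notBi].
    rewrite mulrC -/(eqAmod _ _ _) eqAmod_sym; apply: eqAmodMl => //.
    apply: eqAmod_dvd pk_dv _ => //; apply: eqAmod_expp; rewrite ?rpredM //.
    exact: EinB.
  rewrite mulr0 -/(eqAmod _ _ _) eqAmod_sym -[X in (_ == X %[mod _])%A](mulr0 (a i)).
  apply: eqAmodMl => //; apply: eqAmod_dvd pk_dv _ => //.
  have ZEe : E B * e i \in Aint by rewrite rpredM.
  have := eqAmod_expp n p_gt0 ZEe Aint0 (EnotB i notBi).
  by rewrite expr0n gtn_eqF ?expn_gt0 ?p_gt0.
have: (E B ^+ (p ^ n) * s%:R == 0 %[mod (p ^ k.+1)%N])%A.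
  by rewrite -Ds [y * S]mulrC mulrA -[X in (_ == X %[mod _])%A](mul0r y); apply: eqAmodMr.
case/eqAmod_natP; first by rewrite expn_gt0 p_gt0.
move=> z Zz; rewrite add0r Ds' natrM mulrA expnS natrM mulrA.
move/(mulIf _) => ->; first exact: eqAmodMl0.
by rewrite pnatr_eq0 -lt0n expn_gt0 p_gt0.
Qed.

End PadicLimit.

(** * Characters and classes of prime power size *)

Section PrimePowerClass.

Variables (gT : finGroupType) (G : {group gT}).
Local Open Scope ring_scope.

Lemma card_class_tuples_class m x w : x \in G -> w \in G ->
  (#|class_tuples m (x ^: G) (w ^: G)| * #|G|)%:R
    = \sum_i #|w ^: G|%:R * ('chi[G]_i 1%g * 'chi_i (w^-1)%g) * central_char i x ^+ m.
Proof.
move=> Gx Gw.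
have -> : #|class_tuples m (x ^: G) (w ^: G)|
    = (\sum_(g in w ^: G) #|class_tuples m (x ^: G) [set g]|)%N.
  rewrite -sum1_card (partition_big (fun t : m.-tuple gT => \prod_(y <- t) y)%g [in w ^: G]) /=.
    apply: eq_bigr => g wGg; rewrite sum1dep_card; apply: eq_card => t.
    by rewrite !inE; case: eqP => [->|]; rewrite ?wGg ?andbT ?andbF.
  by move=> t; rewrite inE => /andP[].
rewrite big_distrl /= natr_sum.
have IH g : g \in w ^: G -> (#|class_tuples m (x ^: G) [set g]| * #|G|)%:R
    = \sum_i 'chi[G]_i 1%g * 'chi_i (w^-1)%g * central_char i x ^+ m.
  case/imsetP=> h Gh ->; rewrite card_class_tuples ?groupJ //.
  by apply: eq_bigr => i _; rewrite -conjVg cfunJ // mulrAC.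
rewrite (eq_bigr _ IH) sumr_const -[LHS]mulr_natl mulr_sumr.
by apply: eq_bigr => i _; rewrite !mulrA.
Qed.

(** [x] is central modulo the kernel, because ['Z('chi_i)%CF] maps onto the centre of
    [G / cfker 'chi_i]. *)
Lemma sub_comm_cfker i x : x \in 'Z('chi[G]_i)%CF -> [~: G, <[x]>] \subset cfker 'chi_i.
Proof.
move=> Zx; have Gx := subsetP (cfcenter_sub 'chi_i) x Zx.
have nKG := normal_norm (cfker_normal 'chi[G]_i).
have nKx : <[x]> \subset 'N(cfker 'chi_i) by rewrite cycle_subG (subsetP nKG).
rewrite -quotient_cents2 // centsC quotient_cycle ?(subsetP nKG) //.
rewrite cycle_subG (subsetP (subsetIr (G / cfker 'chi_i)%g _)) //.
have := cfcenter_eq_center i; rewrite /center => <-; exact: mem_quotient.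
Qed.

Lemma sum_irr1_quo (M : {group gT}) : M <| G ->
  \sum_(i | M \subset cfker 'chi[G]_i) `|'chi_i 1%g| ^+ 2 = #|G : M|%:R.
Proof.
move=> nsMG; rewrite -sum_norm_irr_quo // -card_quotient ?normal_norm //.
transitivity (cfReg (G / M) 1%g); last by rewrite cfRegE eqxx.
rewrite cfReg_sum sum_cfunE; apply: eq_bigr => i _.
by rewrite cfunE morph1 ger0_norm ?char1_ge0 ?irr_char.
Qed.

Theorem prime_power_class_p'comm p q x (M : {group gT}) : prime p -> prime q ->
    x \in G -> q.-nat #|x ^: G| -> p != q ->
    M = [~: G, <[x]>] :> {set gT} -> abelian (G / M) -> ~~ (q %| #|G : M|)%N ->
  p^'.-group M.
Proof.
move=> p_pr q_pr Gx qclass neq_pq DM abGM q'GM.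
have nsMG : M <| G.
  by rewrite /normal DM commg_norml commg_subl cycle_subG (subsetP (normG G)).
apply/pgroupP => r r_pr r_dv_M; apply/negP => /= /eqP Drp; rewrite {r}Drp in r_pr r_dv_M.
have [w Mw ow] := Cauchy p_pr r_dv_M.
have Gw : w \in G := subsetP (normal_sub nsMG) w Mw.
(* A [g] with [g ^+ (p ^ c)] conjugate to [w] would have order [p ^ c.+1], which does not divide
   [#|G|]. *)
pose c := logn p #|G|.
have notCw g : g \in G -> (g ^+ (p ^ c))%g \notin (w ^: G).
  move=> Gg; apply/negP => /imsetP[h Gh Dgh].
  have := orderJ w h; rewrite -Dgh ow => og.
  have pg : p.-nat #[g].
    apply: (@pnat_dvd _ (p ^ c.+1)); last by rewrite pnatX pnat_id.
    by rewrite order_dvdn expnSr expgM -{2}og expg_order.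
  have : (#[g] %| p ^ c)%N.
    by rewrite -(part_pnat_id pg) /c -p_part partn_dvd ?order_dvdG.
  by rewrite order_dvdn => /eqP gpc1; move: og p_pr; rewrite gpc1 order1 => <-.
have sKG := class_subG Gx (subxx G).
pose a i := #|w ^: G|%:R * ('chi[G]_i 1%g * 'chi_i (w^-1)%g).
have Za i : a i \in Aint by rewrite /a !rpredM ?rpred_nat ?Aint_irr.
have Zom (i : Iirr G) : central_char i x \in Aint by apply: Aint_central_char.
have power0 d n : (\sum_i a i * central_char i x ^+ (p ^ n * d) == 0 %[mod (p ^ (n - c))%N])%A.
  rewrite -card_class_tuples_class // eqAmod0_nat dvdn_mulr //.
  apply: (@dvdn_class_tuples _ G) => // h g Gh /imsetP[k Gk ->].
  by rewrite -conjgM imset_f ?groupM.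
have [B [nzB inB sumB]] := padic_unit_sum0 p_pr Za Zom power0.
have [k Dk] : exists k, #|x ^: G| = (q ^ k)%N.
  by exists (logn q #|x ^: G|); rewrite -p_part part_pnat_id.
have linD i : M \subset cfker 'chi[G]_i -> 'chi_i \is a linear_char.
  move=> kerM; rewrite lin_irr_der1; apply: subset_trans kerM.
  by rewrite der1_min ?normal_norm.
(* Here ['chi_i] is linear and ['chi_i x] has absolute value 1, so [central_char i x] divides
   [q ^ k], which is prime to [p]. *)
have DinB i : M \subset cfker 'chi[G]_i -> i \in B.
  move/linD=> lin_i; apply: (inB i ('chi_i x)^* (q ^ k)%N).
  - by rewrite Aint_aut Aint_irr.
  - by rewrite Euclid_dvdX // dvdn_prime2 // (negPf neq_pq).
  rewrite /central_char (lin_char1 lin_i) divr1 Dk mulrCA -normCKC.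
  by rewrite normC_lin_char // expr1n mulr1.
(* Burnside: if [q] does not divide the degree, then ['chi_i x = 0], against [i \in B], or [x] lies
   in the centre of ['chi_i], which would put [M] in the kernel. *)
have qB i : i \in B -> ~~ (M \subset cfker 'chi[G]_i) ->
    ('chi_i 1%g * 'chi_i (w^-1)%g == 0 %[mod q])%A.
  move=> Bi nkerM; rewrite -[0](mul0r ('chi_i (w^-1)%g)); apply: eqAmodMr; rewrite ?Aint_irr //.
  rewrite irr1_degree eqAmod0_nat; apply: contraR nkerM => q'i; rewrite DM sub_comm_cfker //.
  apply: contraR (nzB i Bi) => notZx; rewrite /central_char coprime_degree_support_cfcenter //.
    by rewrite mulr0 mul0r.
  by rewrite Dk coprimeXr // irr1_degree natrK coprime_sym prime_coprime.
have: \sum_(i in B) 'chi[G]_i 1%g * 'chi_i (w^-1)%g = 0.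
  apply/eqP; move/eqP: sumB; rewrite -mulr_sumr mulf_eq0 => /orP[|//].
  by rewrite pnatr_eq0 (cardD1 w) class_refl.
rewrite (bigID (fun i => M \subset cfker 'chi[G]_i)) /=.
have -> : \sum_(i in B | M \subset cfker 'chi[G]_i) 'chi_i 1%g * 'chi_i (w^-1)%g = #|G : M|%:R.
  rewrite -sum_irr1_quo //; apply: eq_big => [i | i /andP[_ kerM]].
    by rewrite andb_idl // => /DinB.
  have -> : 'chi_i (w^-1)%g = 'chi_i 1%g.
    by rewrite cfker1 // groupV (subsetP kerM).
  by rewrite ger0_norm ?char1_ge0 ?irr_char // expr2.
move/eqP; rewrite addr_eq0 => /eqP DGM; case/negP: q'GM.
suffices: (#|G : M|%:R == 0 %[mod q])%A by rewrite eqAmod0_nat.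
rewrite DGM eqAmodN oppr0 eqAmod0 rpred_sum // => i /andP[Bi nkerM].
by rewrite -eqAmod0 qB.
Qed.

End PrimePowerClass.

(** * Elements of prime power index *)

Section PrimePowerIndex.

Variable gT : finGroupType.
Implicit Types (G H K N P Q W : {group gT}) (x : gT) (p q : nat).

Lemma pgroup_quotientS (pi : nat_pred) H K W :
  H \subset K -> W \subset 'N(H) -> W \subset 'N(K) -> pi.-group (W / H) -> pi.-group (W / K).
Proof.
by move=> sHK nHW nKW; apply: pnat_dvd; rewrite !card_quotient // indexgS.
Qed.

Lemma mem_pseries2 (pi rho : nat_pred) G W x :
  W <| G -> x \in W -> rho.-group (W / 'O_pi(G)) -> x \in 'O_{pi,rho}(G).
Proof.
move=> nsWG Wx rhoW; apply: subsetP x Wx.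
have nOG := normal_norm (pcore_normal pi G).
rewrite -(quotientSGK (subset_trans (normal_sub nsWG) nOG)).
  by rewrite quotient_pseries2 pcore_max ?quotient_normal.
by have := pseries_sub_catl [:: pi] [:: rho] G; rewrite pseries1.
Qed.

(** The index of ['C_N[x]] in [N] is that of ['C_G[x]] in [N * 'C_G[x]]. *)
Lemma cl_index_normal_dvd G N x : N <| G -> cl_index N x %| cl_index G x.
Proof.
move=> /andP[sNG nNG]; rewrite /cl_index; set C := 'C_G[x]%G.
have sCG : C \subset G by apply: subsetIl.
have nNC := subset_trans sCG nNG.
have -> : #|N : 'C_N[x]| = #|N <*> C : C|.
  rewrite norm_joinEr // -(normC nNC) indexMg -(indexgI N C) /=.
  by rewrite setIA (setIidPl sNG).
by rewrite -(@Lagrange_index _ G (N <*> C)) ?dvdn_mull ?joing_subr // join_subG sNG.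
Qed.

Lemma comm_joing_cycle_normal G x : x \in G ->
  [~: G, <[x]>] <*> <[x]> <| G.
Proof.
move=> Gx; have sxG : <[x]> \subset G by rewrite cycle_subG.
have sLG : [~: G, <[x]>] \subset G by rewrite commg_subl (subset_trans sxG) ?normG.
rewrite /normal join_subG sLG sxG; apply/subsetP=> g Gg.
rewrite inE conjYg join_subG (normsP (commg_norml _ _)) // joing_subl -cycleJ.
rewrite cycle_subG conjg_mulR groupM //; first by rewrite mem_gen // inE cycle_id orbT.
by rewrite mem_gen // inE commGC mem_commg ?cycle_id.
Qed.

Theorem prime_power_index_pseries p q G x : prime p -> prime q -> p != q ->
  x \in G -> p.-elt x -> q.-nat (cl_index G x) -> x \in 'O_{q,p}(G).
Proof.
move=> p_pr q_pr neq_pq; move: {2}_.+1 (ltnSn #|G|) => n.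
elim: n G => // n IHn G; rewrite ltnS => leGn Gx px qGx.
have sxG : <[x]> \subset G by rewrite cycle_subG.
have nsLG : [~: G, <[x]>] <| G.
  by rewrite /normal commg_norml commg_subl (subset_trans sxG) ?normG.
have [sLG nLG] := andP nsLG.
set N := ([~: G, <[x]>] <*> <[x]>)%G.
have nsNG : N <| G := comm_joing_cycle_normal Gx.
have Nx : x \in N by rewrite mem_gen // inE cycle_id orbT.
(* If [N] is proper, induction applies to it, and ['O_{q,p}(N)] is a normal subgroup of [G] that is
   a [p]-group modulo ['O_q(G)]. *)
have [sNG | prNG] := boolP (G \subset N); last first.
  have ltNG : #|N| < #|G|.
    by rewrite proper_card // properE prNG normal_sub.
  have ONx : x \in 'O_{q,p}(N).
    apply: IHn; rewrite ?(leq_trans ltNG) //.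
    exact: pnat_dvd (cl_index_normal_dvd x nsNG) qGx.
  apply: mem_pseries2 ONx _; first exact: char_normal_trans (pseries_char _ _) nsNG.
  have sOO : 'O_q(N) \subset 'O_q(G).
    by rewrite pcore_max ?pcore_pgroup // (char_normal_trans (pcore_char _ _)).
  apply: pgroup_quotientS sOO _ _ _.
  - by rewrite (subset_trans (pseries_sub _ _)) // normal_norm ?pcore_normal.
  - rewrite (subset_trans (pseries_sub _ _)) // (subset_trans (normal_sub nsNG)) //.
    by rewrite normal_norm ?pcore_normal.
  by rewrite /= quotient_pseries2 pcore_pgroup.
set L := [~: G, <[x]>]%G.
have defGL : G / L = <[x]> / L.
  apply/eqP; rewrite eqEsubset (quotientS _ sxG) andbT.
  rewrite (subset_trans (quotientS _ sNG)) // quotientYidl ?(subset_trans sxG) //.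
have pGL : p.-group (G / L) by rewrite defGL quotient_pgroup.
have q'GL : ~~ (q %| #|G : L|).
  rewrite -card_quotient // -p'natE //; apply: sub_in_pnat pGL => r _ /eqnP->.
  by rewrite !inE.
have p'L : p^'.-group L.
  apply: (@prime_power_class_p'comm _ G p q x) => //.
    by rewrite -index_cent1.
  by rewrite defGL quotient_abelian ?cycle_abelian.
have coLx : coprime #|L| #|<[x]>| by rewrite coprime_sym (pnat_coprime px).
have nLx : <[x]> \subset 'N(L) := subset_trans sxG nLG.
(* Coprime action of [<[x]>] on [L]; [Q] is also Sylow in [G], since [#|G : L|] is a power of
   [p]. *)
have [Q sylQ nQx] := sol_coprime_Sylow_exists q (abelian_sol (cycle_abelian x)) nLx coLx.
have sylQG : q.-Sylow(G) Q.
  rewrite pHallE (subset_trans (pHall_sub sylQ)) //= (card_Hall sylQ).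
  by rewrite -(Lagrange sLG) partnM // (part_p'nat (_ : q^'.-nat #|G : L|)) ?muln1 ?p'natE.
have defG : 'C_G[x] * Q = G.
  apply: coprime_index_mulG; rewrite ?subsetIl ?(pHall_sub sylQG) //.
  by apply: pnat_coprime qGx _; case/and3P: sylQG.
(* For [g = c * u] with [c] centralising [x] and [u] in [Q], [[~ g, z]] reduces to [[~ u, z]], which
   lies in [Q] because [z] normalises [Q]. *)
have sLQ : L \subset Q.
  rewrite /= gen_subG; apply/subsetP=> _ /imset2P[g z Gg xz ->].
  have Nz : z \in 'N(Q) by apply: subsetP xz.
  move: Gg; rewrite -defG => /mulsgP[c u /setIP[_ /cent1P cxc] Qu ->].
  have czc : [~ c, z] = 1.
    by apply/eqP/commgP; case/cycleP: xz => i ->; apply: commuteX.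
  by rewrite commMgJ czc conj1g mul1g commgEl groupM ?groupV ?memJ_norm ?groupV.
apply: (@mem_pseries2 _ _ G G) => //; apply: pgroup_quotientS _ nLG _ pGL.
  by rewrite pcore_max // (pgroupS sLQ) // (pHall_pgroup sylQ).
exact: normal_norm (pcore_normal _ _).
Qed.

End PrimePowerIndex.

(** * Sylow subgroups and factorisations *)

Section SylowLemmas.

Variable gT : finGroupType.
Implicit Types (A B G H K N P Q U V W : {group gT}) (x h : gT) (p q r : nat).

Lemma p_power_index_mul_Sylow p G P x :
  p.-Sylow(G) P -> p.-nat (cl_index G x) -> 'C_G[x] * P = G.
Proof.
move=> sylP px; apply: coprime_index_mulG; rewrite ?subsetIl ?(pHall_sub sylP) //.
by apply: pnat_coprime px _; case/and3P: sylP.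
Qed.

(** For a Sylow subgroup [P] containing [x], [G = 'C_G[x] * P]; so all conjugates of [x] are
    conjugates under [P], and its normal closure lies in [P]. *)
Lemma p_power_index_pcore p G x :
  x \in G -> p.-elt x -> p.-nat (cl_index G x) -> x \in 'O_p(G).
Proof.
move=> Gx px pGx; have sxG : <[x]> \subset G by rewrite cycle_subG.
have [P sylP sxP] := Sylow_superset sxG px; rewrite cycle_subG in sxP.
have sxGP : <<x ^: G>> \subset P.
  rewrite gen_subG; apply/subsetP=> _ /imsetP[g Gg ->].
  move: Gg; rewrite -(p_power_index_mul_Sylow sylP pGx).
  case/mulsgP=> c u /setIP[_ /cent1P cxc] Pu ->.
  have -> : x ^ (c * u) = x ^ u by rewrite conjgM; congr (_ ^ _); apply/conjg_fixP/commgP.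
  exact: groupJ.
apply: subsetP (mem_gen (class_refl G x)).
rewrite pcore_max ?(pgroupS sxGP) ?(pHall_pgroup sylP) //.
by rewrite /normal gen_subG class_subG ?norms_gen ?class_norm.
Qed.

Lemma p'_index_cent_Sylow p G x : p^'.-nat (cl_index G x) ->
  exists2 Q : {group gT}, p.-Sylow(G) Q & x \in 'C(Q).
Proof.
move=> p'x; have [Q sylQ] := Sylow_exists p 'C_G[x]; exists Q.
  rewrite pHallE (subset_trans (pHall_sub sylQ)) ?subsetIl //= (card_Hall sylQ).
  by rewrite -(Lagrange (subsetIl G 'C[x])) partnM // (part_p'nat p'x) muln1.
have := pHall_sub sylQ; rewrite subsetI => /andP[_].
by rewrite -sub_cent1.
Qed.

Lemma p'_index_cent_pcore p G x : p^'.-nat (cl_index G x) -> x \in 'C('O_p(G)).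
Proof.
case/p'_index_cent_Sylow=> Q sylQ cQx; apply: subsetP cQx.
by apply: centS; apply: pcore_sub_Hall.
Qed.

(** [x] centralises some Sylow [p]-subgroup of [G]. This is a conjugate of [P], so its image is the
    normal subgroup [P / K]. *)
Lemma p'_index_cent_quotient p G K P x : K <| G -> p.-Sylow(G) P -> P / K <| G / K ->
  x \in G -> p^'.-nat (cl_index G x) -> coset K x \in 'C(P / K).
Proof.
move=> nsKG sylP nsPK Gx; case/p'_index_cent_Sylow=> Q sylQ cQx.
have nKG := normal_norm nsKG.
have [g Gg defP] := Sylow_trans sylQ sylP.
have -> : P / K = Q / K.
  have : (P / K) :^ (coset K g^-1) = P / K.
    by rewrite (normsP (normal_norm nsPK)) // mem_quotient ?groupV.
  move <-; rewrite -quotientJ ?(subsetP nKG) ?groupV // defP conjsgK //.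
by apply: subsetP (quotient_cent _ _) _ _; rewrite mem_quotient.
Qed.

Lemma Sylow_factorization p G A B : A * B = G ->
  exists P : {group gT}, [/\ p.-Sylow(G) P, p.-Sylow(A) (P :&: A),
    p.-Sylow(B) (P :&: B) & (P :&: A) * (P :&: B) = P].
Proof.
move=> defG.
have [sAG sBG] : A \subset G /\ B \subset G by rewrite -defG mulG_subl mulG_subr.
have [S sylS] := Sylow_exists p A; have [T sylT] := Sylow_exists p B.
have [sSA sTB] := (pHall_sub sylS, pHall_sub sylT).
have [R sylR sSR] := Sylow_superset (subset_trans sSA sAG) (pHall_pgroup sylS).
have [g Gg sTR] := Sylow_Jsub sylR (subset_trans sTB sBG) (pHall_pgroup sylT).
(* Splitting the conjugating element along [A * B] gives one conjugate of [R] that contains Sylow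
   subgroups of both [A] and [B]. *)
have [a [b [Aa Bb Dg]]] : exists a b, [/\ a \in A, b \in B & g = b^-1 * a^-1].
  have : g^-1 \in A * B by rewrite defG groupV.
  by case/mulsgP=> a b Aa Bb Dg; exists a, b; rewrite -invMg -Dg invgK.
pose P := (R :^ a)%G.
have Ga := subsetP sAG a Aa; have sylP : p.-Sylow(G) P by rewrite pHallJ.
have pP := pHall_pgroup sylP.
have sylSa : p.-Sylow(A) (S :^ a)%G by rewrite pHallJ.
have sylTb : p.-Sylow(B) (T :^ b^-1)%G by rewrite pHallJ ?groupV.
have sSP : S :^ a \subset P by rewrite conjSg.
have sTP : T :^ b^-1 \subset P by rewrite -sub_conjgV -conjsgM -Dg.
have sylA : p.-Sylow(A) (P :&: A).
  rewrite (sub_pHall sylSa (pgroupS (subsetIl P A) pP)) ?subsetIr //.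
  by rewrite subsetI sSP (pHall_sub sylSa).
have sylB : p.-Sylow(B) (P :&: B).
  rewrite (sub_pHall sylTb (pgroupS (subsetIl P B) pP)) ?subsetIr //.
  by rewrite subsetI sTP (pHall_sub sylTb).
exists P; split=> //; apply/eqP; rewrite eqEcard mul_subG ?subsetIl //=.
(* Comparing [p]-parts in [#|A| * #|B| = #|G| * #|A :&: B|] shows that the product has at least
   [#|P|] elements. *)
have le_I : #|P :&: A :&: (P :&: B)| <= #|A :&: B|`_p.
  rewrite setIACA setIid dvdn_leq // -(part_pnat_id (pgroupS (subsetIl P _) pP)).
  by rewrite partn_dvd // cardSg ?subsetIr.
have := mul_cardG (P :&: A) (P :&: B); rewrite /= (card_Hall sylA) (card_Hall sylB).
rewrite -partnM // mul_cardG defG partnM // -(card_Hall sylP) => eq_card.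
by rewrite -(leq_pmul2r (part_gt0 p #|A :&: B|)) eq_card leq_mul2l le_I orbT.
Qed.

Lemma p'group_cent p G H (Y : {set gT}) : H \subset G -> p^'.-group H ->
    (forall r h, prime r -> r != p -> h \in G -> r.-elt h -> h \in 'C(Y)) ->
  H \subset 'C(Y).
Proof.
move=> sHG p'H cY; rewrite -(Sylow_gen H) gen_subG; apply/bigcupsP=> R /SylowP[r r_pr sylR].
have [sRH rR _] := and3P sylR.
have [-> | ntR] := eqsVneq R 1; first by rewrite sub1G.
apply/subsetP=> h Rh; apply: (cY r) => //.
- apply: contraTneq (pgroupS sRH p'H) => Drp; rewrite -Drp.
  have [_ r_dv_R _] := pgroup_pdiv rR ntR.
  by apply/negP=> /pgroupP/(_ r r_pr r_dv_R); rewrite !inE eqxx.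
- exact: subsetP sHG _ (subsetP sRH _ Rh).
exact: mem_p_elt rR Rh.
Qed.

(** By Schur-Zassenhaus [P] has a complement; it is a [p']-group, hence centralises [P], and the
    product is direct. *)
Lemma p_decomposable_crit p G P : p.-Sylow(G) P -> P <| G ->
    (forall r h, prime r -> r != p -> h \in G -> r.-elt h -> h \in 'C(P)) ->
  p_decomposable p G.
Proof.
move=> sylP nsPG cP.
have [H] := splitsP (SchurZassenhaus_split (pHall_Hall sylP) nsPG).
case/complP=> tiPH defG; have sHG : H \subset G by rewrite -defG mulG_subr.
have p'H : p^'.-group H.
  have := TI_cardMg tiPH; rewrite defG => oG.
  have : p^'.-nat #|G : P| by case/and3P: sylP.
  by rewrite -divgS ?normal_sub // oG mulKn.
have cHP := p'group_cent sHG p'H cP.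
have defPH : P \x H = G by rewrite dprodE.
rewrite /p_decomposable (normal_Hall_pcore sylP nsPG).
have [_ nsHG] := dprod_normal2 defPH.
suffices -> : 'O_p^'(G) = H by [].
apply: normal_Hall_pcore nsHG; rewrite /pHall sHG p'H.
rewrite pnatNK -divgS // -defG TI_cardMg // mulnK //.
exact: pHall_pgroup sylP.
Qed.

(** [G] is generated by [P] and one Sylow subgroup for each other prime, and all of these normalise
    [P]. *)
Lemma Sylow_normal_crit p G P : p.-Sylow(G) P ->
    (forall r h, prime r -> r != p -> h \in G -> r.-elt h -> h \in 'C(P)) ->
  P <| G.
Proof.
move=> sylP cP; rewrite /normal (pHall_sub sylP).
pose T := P |: [set R : {group gT} | (R \subset G) && (R \subset 'N(P))].
have <- : <<\bigcup_(R in T) R>> = G.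
  apply: Sylow_transversal_gen => [R /setU1P[-> | ] | r].
  - exact: pHall_sub sylP.
  - by rewrite inE => /andP[].
  rewrite mem_primes => /and3P[r_pr _ _].
  have [-> | neq_rp] := eqVneq r p; first by exists P; rewrite // setU11.
  have [R sylR] := Sylow_exists r G; exists R => //.
  rewrite setU1r // inE (pHall_sub sylR) (subset_trans _ (cent_sub P)) //.
  apply/subsetP=> h Rh; apply: (cP r) => //.
    exact: subsetP (pHall_sub sylR) h Rh.
  exact: mem_p_elt (pHall_pgroup sylR) Rh.
rewrite gen_subG; apply/bigcupsP=> R /setU1P[-> | ]; first exact: normG.
by rewrite inE => /andP[].
Qed.

(** As [U / V] is a chief factor, [U] is generated by [V] and [U :&: K']. So [#|U / V|] divides the
    order of [(U :&: K') / K], a subgroup of [K' / K]. *)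
Lemma chief_factor_pgroup (pi : nat_pred) G U V K K' : chief_factor G V U ->
    K <| G -> K' <| G -> U :&: K \subset V -> ~~ (U :&: K' \subset V) ->
  pi.-group (K' / K) -> pi.-group (U / V).
Proof.
case/andP=> /maxgroupP[/andP[prVU nVG] maxV] nsUG nsKG nsK'G sUKV nsUK'V piK.
have [sUG nUG] := andP nsUG; have sVU := proper_sub prVU.
have nVU := subset_trans sUG nVG.
have sIU : U :&: K' \subset U := subsetIl _ _.
have defU : V <*> (U :&: K') = U.
  apply/eqP; rewrite eqEproper join_subG sVU sIU /=; apply: contra nsUK'V => prU.
  rewrite -{1}(maxV (V <*> (U :&: K'))%G) ?joing_subl ?joing_subr //=.
  by rewrite prU normsY // normsI // normal_norm.
have -> : U / V = (U :&: K') / V.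
  by rewrite -{1}defU quotientYidl // (subset_trans sIU).
have nKIU : U :&: K' \subset 'N(K).
  by rewrite (subset_trans sIU) // (subset_trans sUG) // normal_norm.
have piI : pi.-group ((U :&: K') / K) by rewrite (pgroupS _ piK) ?quotientS ?subsetIr.
apply: pnat_dvd piI; rewrite !card_quotient ?(subset_trans sIU nVU) //.
rewrite -[X in _ %| X]indexgI indexgS //= -setIA.
by apply: subset_trans sUKV; rewrite setIS // subsetIr.
Qed.

End SylowLemmas.

(** * Consequences of a p-Baer factorisation *)

Lemma quotient_normal_mulg (gT : finGroupType) (G K P : {group gT}) :
  K <| G -> P \subset G -> P / K <| G / K -> P * K <| G.
Proof.
move=> nsKG sPG nsPK; have nKP := subset_trans sPG (normal_norm nsKG).
by rewrite (normC nKP) -quotientK // -(quotientGK nsKG) cosetpre_normal.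
Qed.

Section BaerFactorisation.

Variables (gT : finGroupType) (p : nat) (G A B : {group gT}).
Hypothesis hBaer : p_baer_factorisation p G A B.
Implicit Types (H K P Q W X : {group gT}) (x h : gT).

Lemma baer_prime : prime p.
Proof. by case: hBaer; rewrite mem_primes => /and3P[]. Qed.

Lemma baer_mem x : x \in A :|: B -> x \in G.
Proof.
case: hBaer => _ defG _; apply: subsetP; rewrite subUset -defG.
by rewrite mulG_subl mulG_subr.
Qed.

Lemma baer_index_cases x : x \in A :|: B -> p.-elt x ->
  p.-nat (cl_index G x) \/
  p^'.-nat (cl_index G x) /\ exists q : nat, [/\ prime q, q != p & x \in 'O_{q,p}(G)].
Proof.
move=> ABx px; have [_ _ /(_ x ABx px)[q [k [q_pr Dq]]]] := hBaer.
have qx : q.-nat (cl_index G x) by rewrite Dq pnatX pnat_id.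
have [<- | neq_qp] := eqVneq q p; [by left | right].
split; first by apply: sub_in_pnat qx => r _ /eqnP->; rewrite !inE.
exists q; split; rewrite // prime_power_index_pseries ?baer_prime ?baer_mem //.
by rewrite eq_sym.
Qed.

(** Some Sylow [p]-subgroup is the product of its intersections with [A] and [B]; being normal, [K]
    then contains its conjugates too. *)
Lemma baer_Sylow_sub K P : K <| G -> p.-Sylow(G) P ->
  {in A :|: B, forall x, p.-elt x -> x \in K} -> P \subset K.
Proof.
move=> nsKG sylP sK; have [_ defG _] := hBaer.
have [P0 [sylP0 _ _ defP0]] := Sylow_factorization p defG.
have pP0 := pHall_pgroup sylP0.
have [g Gg ->] := Sylow_trans sylP0 sylP.
rewrite -(normsP (normal_norm nsKG) g Gg) conjSg -defP0 mul_subG //.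
  apply/subsetP=> x /setIP[P0x Ax]; apply: sK; first by rewrite inE Ax.
  exact: mem_p_elt pP0 P0x.
apply/subsetP=> x /setIP[P0x Bx]; apply: sK; first by rewrite inE Bx orbT.
exact: mem_p_elt pP0 P0x.
Qed.

(** * Sylow subgroups modulo a normal subgroup, and the [p]-length *)

Lemma mem_quotient_pcore K W x : K <| G -> W <| G -> p.-group (W / K) -> x \in W ->
  coset K x \in 'O_p(G / K).
Proof.
move=> nsKG nsWG pWK Wx; have nKW := subset_trans (normal_sub nsWG) (normal_norm nsKG).
apply: (subsetP (_ : W / K \subset _)); last exact: mem_quotient.
by rewrite pcore_max // quotient_normal.
Qed.

(** Modulo such a [K], both ['O_p(G)] and the ['O_{q,p}(G)] become [p]-groups, so the [p]-elements
    of [A] and [B] map into ['O_p(G / K)]. *)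
Lemma baer_quotient_normal K P : K <| G -> p.-Sylow(G) P ->
    (forall q : nat, prime q -> q != p -> 'O_q(G) \subset K) ->
  P / K <| G / K.
Proof.
move=> nsKG sylP sOK; have nKG := normal_norm nsKG.
have nsWG : coset K @*^-1 'O_p(G / K) <| G.
  by rewrite -{2}(quotientGK nsKG) cosetpre_normal pcore_normal.
have sPW : P \subset coset K @*^-1 'O_p(G / K).
  apply: (@baer_Sylow_sub (coset K @*^-1 'O_p(G / K))%G) => // x ABx px.
  have Gx := baer_mem ABx; rewrite mem_morphpre ?(subsetP nKG) //=.
  have [pGx | [_ [q [q_pr neq_qp Ox]]]] := baer_index_cases ABx px.
    apply: mem_quotient_pcore (pcore_normal p G) _ _ => //.
      by rewrite quotient_pgroup ?pcore_pgroup.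
    exact: p_power_index_pcore.
  apply: mem_quotient_pcore (pseries_normal _ G) _ Ox => //.
  apply: pgroup_quotientS (sOK q q_pr neq_qp) _ _ _.
  - by rewrite (subset_trans (pseries_sub _ _)) // normal_norm ?pcore_normal.
  - by rewrite (subset_trans (pseries_sub _ _)).
  by rewrite /= quotient_pseries2 pcore_pgroup.
have sylPK : p.-Sylow(G / K) (P / K).
  by rewrite quotient_pHall ?(subset_trans (pHall_sub sylP)).
have -> : P / K = 'O_p(G / K).
  apply/eqP; rewrite eqEsubset pcore_sub_Hall // andbT.
  by rewrite sub_quotient_pre // (subset_trans (pHall_sub sylP)).
exact: pcore_normal.
Qed.

Lemma pcore_sub_p'core (q : nat) : q != p -> 'O_q(G) \subset 'O_p^'(G).
Proof. by move=> neq_qp; apply: sub_pcore => r /eqnP->. Qed.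

Lemma pcore_sub_Fitting (q : nat) : 'O_q(G) \subset 'F(G).
Proof. by rewrite -p_core_Fitting pcore_sub. Qed.

Lemma baer_p'core_quotient_normal P : p.-Sylow(G) P -> P / 'O_p^'(G) <| G / 'O_p^'(G).
Proof.
move=> sylP; apply: baer_quotient_normal (pcore_normal _ _) sylP _ => q _.
exact: pcore_sub_p'core.
Qed.

Lemma baer_Fitting_quotient_normal P : p.-Sylow(G) P -> P / 'F(G) <| G / 'F(G).
Proof.
move=> sylP; apply: baer_quotient_normal (Fitting_normal _) sylP _ => q _ _.
exact: pcore_sub_Fitting.
Qed.

Lemma baer_Sylow_sub_pseries P : p.-Sylow(G) P -> P \subset 'O_{p^',p}(G).
Proof.
move=> sylP; have nRG := normal_norm (pcore_normal p^' G).
have sPG := pHall_sub sylP.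
rewrite -(quotientSGK (subset_trans sPG nRG)); last first.
  by have := pseries_sub_catl [:: (p^' : nat_pred)] [:: (p : nat_pred)] G; rewrite pseries1.
rewrite quotient_pseries2 pcore_max ?baer_p'core_quotient_normal //.
by rewrite quotient_pgroup ?(pHall_pgroup sylP).
Qed.

Lemma baer_p'quotient : p^'.-group (G / 'O_{p^',p}(G)).
Proof.
have [P sylP] := Sylow_exists p G; rewrite /pgroup card_quotient ?normal_norm ?pseries_normal //.
have : p^'.-nat #|G : P| by case/and3P: sylP.
by apply: pnat_dvd; rewrite indexgS ?baer_Sylow_sub_pseries.
Qed.

(** In the series 1, ['O_p^'(G)], ['O_{p^',p}(G)], [G], take the first term whose intersection with
    [U] is not in [V]; the corresponding factor decides the type of [U / V]. *)
Lemma baer_p_soluble : p_soluble p G.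
Proof.
move=> U V chUV; have [sUG _] := andP (proj2 (andP chUV)).
have nsRG : 'O_p^'(G) <| G := pcore_normal _ G.
have nsOG : 'O_{p^',p}(G) <| G := pseries_normal _ G.
have [sUR | nsUR] := boolP (U :&: 'O_p^'(G) \subset V); last first.
  right; apply: chief_factor_pgroup (normal1 G) nsRG _ nsUR _ => //.
    by rewrite setIC (setIidPl (sub1G _)) sub1G.
  by rewrite quotient_pgroup ?pcore_pgroup.
have [sUO | nsUO] := boolP (U :&: 'O_{p^',p}(G) \subset V); last first.
  left; apply: chief_factor_pgroup nsRG nsOG _ nsUO _ => //.
  by rewrite /= quotient_pseries2 pcore_pgroup.
right; apply: chief_factor_pgroup nsOG (normal_refl G) sUO _ baer_p'quotient => //.
rewrite (setIidPl sUG); case/andP: chUV => /maxgroupP[/andP[/andP[]]] //.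
Qed.

Lemma baer_p_length1 : p_length_eq p G 1.
Proof.
split=> [|[|//] _].
  rewrite /upper_p'p /=; set pis := [:: (p^' : nat_pred); (p : nat_pred)].
  have := quotient_pseries pis p^' G; rewrite /= pcore_pgroup_id ?baer_p'quotient //.
  apply: quotient_inj; rewrite ?pseries_normal //.
  rewrite /normal (pseries_sub_catl pis [:: (p^' : nat_pred)] G).
  by rewrite (subset_trans (pseries_sub _ _)) // normal_norm ?pseries_normal.
(* For [m = 0] the term is ['O_p^'(G)], which is not [G] because [p \in \pi(G)]. *)
rewrite /upper_p'p /= pseries1 => defR; case: hBaer; rewrite mem_primes => /and3P[_ _ p_dv_G _ _].
have := pcore_pgroup p^' G; rewrite [pcore _ _]defR => /pgroupP/(_ p baer_prime p_dv_G).
by rewrite !inE eqxx.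
Qed.

(** A [p]-element of [A] or [B] lies in ['O_p(G)] if its index is a power of [p]; otherwise its
    index is prime to [p], and its image is central in [P / K]. *)
Lemma baer_quotient_sub K P : K <| G -> p.-Sylow(G) P -> P / K <| G / K ->
  P / K \subset ('O_p(G) / K) <*> 'Z(P / K).
Proof.
move=> nsKG sylP nsPK; have nKG := normal_norm nsKG.
have nKP := subset_trans (pHall_sub sylP) nKG.
have sylPK : p.-Sylow(G / K) (P / K) by rewrite quotient_pHall.
set T := (('O_p(G) / K) <*> 'Z(P / K))%G.
have nsTG : T <| G / K.
  by rewrite normalY ?quotient_normal ?pcore_normal // (char_normal_trans (center_char _)).
rewrite sub_quotient_pre //; apply: (@baer_Sylow_sub (coset K @*^-1 T)%G) => //.
  by rewrite -{1}(quotientGK nsKG) cosetpre_normal.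
move=> x ABx px; have Gx := baer_mem ABx; rewrite mem_morphpre ?(subsetP nKG) //=.
have [pGx | [p'Gx _]] := baer_index_cases ABx px.
  apply: (subsetP (joing_subl _ _)); rewrite mem_quotient //.
  exact: p_power_index_pcore.
apply: (subsetP (joing_subr _ _)); rewrite inE (p'_index_cent_quotient nsKG sylP nsPK) //.
by rewrite (mem_normal_Hall sylPK) ?mem_quotient // morph_p_elt ?(subsetP nKG).
Qed.

Lemma baer_Sylow_quotient_Fitting_abelian P : p.-Sylow(G) P -> abelian (P / 'F(G)).
Proof.
move=> sylP; have nsP := baer_Fitting_quotient_normal sylP.
have := baer_quotient_sub (Fitting_normal G) sylP nsP.
rewrite (quotientS1 (pcore_sub_Fitting p)) joing1G => sPZ.
exact: abelianS sPZ (center_abelian _).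
Qed.

Lemma Sylow_isog_p'core_quotient P : p.-Sylow(G) P -> P \isog P / 'O_p^'(G).
Proof.
move=> sylP; apply: quotient_isog.
  exact: subset_trans (pHall_sub sylP) (normal_norm (pcore_normal _ _)).
apply: coprime_TIg; rewrite coprime_sym.
exact: pnat_coprime (pHall_pgroup sylP) (pcore_pgroup _ _).
Qed.

Lemma baer_Sylow_abelian P : p.-Sylow(G) P -> abelian P = abelian 'O_p(G).
Proof.
move=> sylP; have nsP := baer_p'core_quotient_normal sylP.
apply/idP/idP=> [|abZ]; first exact: abelianS (pcore_sub_Hall sylP).
rewrite (isog_abelian (Sylow_isog_p'core_quotient sylP)).
have sZP : 'O_p(G) / 'O_p^'(G) \subset P / 'O_p^'(G) by rewrite quotientS ?pcore_sub_Hall.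
apply: abelianS (baer_quotient_sub (pcore_normal _ _) sylP nsP) _.
rewrite abelianY quotient_abelian // center_abelian.
by apply: subset_trans (subsetIr _ _) (centS sZP).
Qed.

(** * The action of [G] on ['O_p(G)] *)

Let Z := 'O_p(G)%G.
Let C := 'C_G(Z)%G.

Lemma cent_pcore_normal : C <| G.
Proof. by rewrite /normal subsetIl normsI ?normG // norms_cent // normal_norm ?pcore_normal. Qed.

Lemma baer_Sylow_sub_cent P : p.-Sylow(G) P -> P \subset Z * C.
Proof.
move=> sylP; have nCZ : Z \subset 'N(C).
  exact: subset_trans (pcore_sub _ _) (normal_norm cent_pcore_normal).
rewrite -norm_joinEl //; apply: (@baer_Sylow_sub (Z <*> C)%G) sylP _.
  by rewrite normalY ?pcore_normal ?cent_pcore_normal.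
move=> x ABx px; have Gx := baer_mem ABx.
have [pGx | [p'Gx _]] := baer_index_cases ABx px.
  exact: subsetP (joing_subl _ _) _ (p_power_index_pcore Gx px pGx).
by apply: subsetP (joing_subr _ _) _ _; rewrite inE Gx p'_index_cent_pcore.
Qed.

(** The index of [x] is prime to [r], so [x] centralises a Sylow [r]-subgroup, which contains some
    [h ^ g]. Write [g^-1 = c * d * z] with [c] in ['C_G[x]], [d] in [C], [z] in [Z]; then [c] and
    [d] fix [x], and [x ^ z = x ^ g^-1] commutes with [h]. *)
Lemma baer_p_power_index_conj_cent r x h : prime r -> r != p -> x \in G -> p.-elt x ->
    p.-nat (cl_index G x) -> h \in G -> r.-elt h ->
  exists2 z, z \in Z & x ^ z \in 'C[h].
Proof.
move=> r_pr neq_rp Gx px pGx Gh rh.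
have [P sylP] := Sylow_exists p G.
have r'x : r^'.-nat (cl_index G x) by apply: sub_in_pnat pGx => q _ /eqnP->; rewrite !inE eq_sym.
have [Q sylQ cQx] := p'_index_cent_Sylow r'x.
have shG : <[h]> \subset G by rewrite cycle_subG.
have [g Gg sQ] := Sylow_Jsub sylQ shG rh.
have : g^-1 \in 'C_G[x] * P by rewrite (p_power_index_mul_Sylow sylP pGx) groupV.
case/mulsgP=> c u /setIP[_ /cent1P cxc] Pu Dg.
have : u \in C * Z.
  rewrite normC ?(subsetP (baer_Sylow_sub_cent sylP)) //.
  exact: subset_trans (subsetIl _ _) (normal_norm (pcore_normal _ _)).
case/mulsgP=> d z /setIP[_ cZd] Zz Du; exists z => //.
have cxc' : x ^ c = x by apply/conjg_fixP/commgP.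
have Zx : x \in Z by apply: p_power_index_pcore.
have cxd : x ^ d = x by apply/conjg_fixP/commgP; apply/commute_sym/(centP cZd).
have -> : x ^ z = x ^ g^-1 by rewrite Dg Du !conjgM cxc' cxd.
have Qhg : h ^ g \in Q by rewrite (subsetP sQ) // memJ_conjg cycle_id.
by rewrite -mem_conjg -cent1J; apply/cent1P/(centP cQx).
Qed.

(* Each x in A or B that has p-power index has a 'O_p(G)-conjugate centralised by h. Hence h acts
   trivially on the Frattini quotient of 'O_p(G), modulo the centre. *)
Lemma baer_pcore_cent_mul r h : prime r -> r != p -> h \in G -> r.-elt h ->
  Z \subset 'C_Z[h] * 'Z(Z).
Proof.
move=> r_pr neq_rp Gh rh; have pZ : p.-group Z := pcore_pgroup p G.
have [_ defG _] := hBaer; have [P [sylP _ _ defP]] := Sylow_factorization p defG.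
have pP := pHall_pgroup sylP; have sZP : Z \subset P := pcore_sub_Hall sylP.
set X := ('C_Z[h] <*> 'Z(Z))%G; pose W := ('Phi(Z) <*> X)%G.
have sXZ : X \subset Z by rewrite join_subG !subsetIl.
have sWZ : W \subset Z by rewrite join_subG Phi_sub.
have genP x : x \in A :|: B -> x \in P -> x \in W <*> C.
  move=> ABx Px; have [Gx px] := (baer_mem ABx, mem_p_elt pP Px).
  have [pGx | [p'Gx _]] := baer_index_cases ABx px; last first.
    by apply: subsetP (joing_subr _ _) _ _; rewrite inE Gx p'_index_cent_pcore.
  apply: (subsetP (joing_subl _ _)).
  have [z Zz cxz] := baer_p_power_index_conj_cent r_pr neq_rp Gx px pGx Gh rh.
  have Zx : x \in Z by apply: p_power_index_pcore.
  have Xxz : x ^ z \in X by rewrite mem_gen // inE inE cxz groupJ.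
  (* [x] differs from [x ^ z] by a commutator of [Z], which lies in ['Phi(Z)]. *)
  have Phixz : [~ x ^ z, z^-1] \in 'Phi(Z).
    rewrite (Phi_joing pZ) mem_gen // inE mem_commg ?groupJ ?groupV //.
  by rewrite -[x](conjgK z) conjg_mulR groupM // mem_gen // inE ?Phixz ?Xxz ?orbT.
have sPWC : P \subset W <*> C.
  rewrite -{1}defP mul_subG //; apply/subsetP=> x /setIP[Px Xx].
    by rewrite genP // inE Xx.
  by rewrite genP // inE Xx orbT.
have nCW : W \subset 'N(C).
  apply: subset_trans (normal_norm cent_pcore_normal).
  exact: subset_trans sWZ (pcore_sub _ _).
(* By the modular law [Z = W * (C :&: Z)], and [C :&: Z] is ['Z(Z)], contained in [W]. *)
have sZW : Z \subset W.
  have : Z \subset W * C :&: Z.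
    by rewrite subsetI subxx andbT -norm_joinEl // (subset_trans sZP).
  rewrite -group_modl // => /subset_trans; apply; rewrite mul_subG //.
  apply: subset_trans (joing_subr _ _); apply: subset_trans (joing_subr _ _).
  by rewrite setIC setIS // subsetIr.
(* ['Phi(Z)] consists of non-generators, so [Z = X]. *)
have defZ : 'Phi(Z) <*> X = Z by apply/eqP; rewrite eqEsubset sWZ.
have := Phi_nongen defZ; rewrite genGid => {1}<-.
rewrite /= cent_joinEr //; apply: subset_trans (subsetIr _ _) _.
by rewrite centS ?subsetIl.
Qed.

(** With [x ^ z] in ['C[h]], write [z = v * c] with [v] in ['Z(Z)] and [c] in ['C_Z[h]]: [v] fixes
    [x], which lies in [Z], and conjugation by [c] preserves ['C[h]]. *)
Lemma baer_p_power_index_cent r x h : prime r -> r != p -> x \in G -> p.-elt x ->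
    p.-nat (cl_index G x) -> h \in G -> r.-elt h -> x \in 'C[h].
Proof.
move=> r_pr neq_rp Gx px pGx Gh rh.
have [z Zz cxz] := baer_p_power_index_conj_cent r_pr neq_rp Gx px pGx Gh rh.
have Zx : x \in Z by apply: p_power_index_pcore.
have nZX : 'C_Z[h] \subset 'N('Z(Z)).
  exact: subset_trans (subsetIl _ _) (normal_norm (center_normal _)).
have : z \in 'Z(Z) * 'C_Z[h].
  by rewrite -(normC nZX) (subsetP (baer_pcore_cent_mul r_pr neq_rp Gh rh)).
case/mulsgP=> v c /setIP[_ cZv] /setIP[_ cc] Dz.
have cxv : x ^ v = x by apply/conjg_fixP/commgP; apply/commute_sym/(centP cZv).
by move: cxz; rewrite Dz conjgM cxv groupJr.
Qed.

(** [P] and [Z] have the same image modulo [C], and an [r]-element with [r != p] centralises [Z]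
    modulo ['Z(Z)], which is contained in [C]. *)
Lemma baer_quotient_cent_pcore_decomposable : p_decomposable p (G / C)%G.
Proof.
have [P sylP] := Sylow_exists p G; have sPG := pHall_sub sylP.
have nCG := normal_norm cent_pcore_normal.
have nCZ : Z \subset 'N(C) := subset_trans (pcore_sub _ _) nCG.
have sylPC : p.-Sylow(G / C) (P / C) by rewrite quotient_pHall ?(subset_trans sPG).
have defPC : P / C = Z / C.
  apply/eqP; rewrite eqEsubset [Z / C \subset _]quotientS ?pcore_sub_Hall // andbT.
  by apply: subset_trans (quotientS C (baer_Sylow_sub_cent sylP)) _; rewrite quotientMidr.
apply: p_decomposable_crit sylPC _ _; first by rewrite /= defPC quotient_normal ?pcore_normal.
move=> r hC r_pr neq_rp /morphimP[h0 Nh0 Gh0 DhC] rhC.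
have [h [Gh rh ->]] : exists h, [/\ h \in G, r.-elt h & hC = coset C h].
  exists h0.`_r; rewrite groupX // p_elt_constt; split=> //.
  by rewrite -[LHS](constt_p_elt rhC) DhC /= morph_constt.
have Nh := subsetP nCG h Gh; rewrite /= defPC; apply/centP=> _ /morphimP[z Nz Zz ->].
have := subsetP (baer_pcore_cent_mul r_pr neq_rp Gh rh) z Zz.
case/mulsgP=> c v /setIP[Zc /cent1P cch] /setIP[Zv cZv] ->.
have [Nc Nv] := (subsetP nCZ c Zc, subsetP nCZ v Zv).
have Cv : v \in C by rewrite inE cZv (subsetP (pcore_sub p G)).
rewrite /commute /= morphM //= (coset_id Cv) mulg1.
by rewrite -!morphM // cch.
Qed.

(** Elements of [P :&: X] outside [C] have [p]-power index, hence commute with [h]; an element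
    inside [C] is a quotient of two elements outside. *)
Lemma baer_centralised_sub P X : p.-Sylow(G) P -> X \subset A :|: B ->
    ~~ (P :&: X \subset C) ->
  forall r h, prime r -> r != p -> h \in G -> r.-elt h -> h \in 'C(P :&: X).
Proof.
move=> sylP sXAB /subsetPn[x0 PXx0 notCx0] r h r_pr neq_rp Gh rh.
have pPX := pgroupS (subsetIl P X) (pHall_pgroup sylP).
have notC x : x \in P :&: X -> x \notin C -> x \in 'C[h].
  move=> PXx notCx; have px := mem_p_elt pPX PXx.
  have ABx : x \in A :|: B by case/setIP: PXx => _ /(subsetP sXAB).
  have Gx := baer_mem ABx.
  have [pGx | [p'Gx _]] := baer_index_cases ABx px.
    exact: baer_p_power_index_cent pGx Gh rh.
  by case/negP: notCx; rewrite inE Gx p'_index_cent_pcore.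
rewrite -sub_cent1; apply/subsetP=> y PXy; have [Cy | ] := boolP (y \in C); last exact: notC.
rewrite -(groupMl _ (notC x0 PXx0 notCx0)); apply: notC; first exact: groupM.
by rewrite (groupMr _ Cy).
Qed.

(** For [x], [y] in [P :&: X]: if [x] has [p]-power index, it lies in ['O_p(G)], which [y]
    centralises; otherwise [x] is central in [P] modulo ['O_p^'(G)], and this core meets [P]
    trivially. *)
Lemma baer_sub_cent_abelian P X : p.-Sylow(G) P -> X \subset A :|: B ->
  P :&: X \subset C -> abelian (P :&: X).
Proof.
move=> sylP sXAB sPXC; have sPG := pHall_sub sylP.
have nsP := baer_p'core_quotient_normal sylP.
have pPX := pgroupS (subsetIl P X) (pHall_pgroup sylP).
have nRG := normal_norm (pcore_normal p^' G).
have tiRP : 'O_p^'(G) :&: P = 1.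
  apply: coprime_TIg; rewrite coprime_sym.
  exact: pnat_coprime (pHall_pgroup sylP) (pcore_pgroup _ _).
apply/centsP=> x PXx y PXy; have [Px Xx] := setIP PXx; have [Py _] := setIP PXy.
have ABx := subsetP sXAB x Xx; have px := mem_p_elt pPX PXx.
have Gx := baer_mem ABx; have Gy := subsetP sPG y Py.
have [pGx | [p'Gx _]] := baer_index_cases ABx px.
  have /setIP[_ cZy] := subsetP sPXC y PXy.
  by apply/commute_sym/(centP cZy)/p_power_index_pcore.
have cRx := p'_index_cent_quotient (pcore_normal _ _) sylP nsP Gx p'Gx.
suffices : [~ x, y] \in 'O_p^'(G) :&: P by rewrite tiRP => /set1P/eqP/commgP.
rewrite inE (groupR Px Py) andbT.
have [Nx Ny] := (subsetP nRG x Gx, subsetP nRG y Gy).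
apply: coset_idr; rewrite ?groupR // morphR //.
by apply/eqP/commgP; apply: (centP cRx); rewrite mem_quotient.
Qed.

Lemma baer_nonabelian_decomposable :
    (forall Q, p.-Sylow(A) Q -> ~~ abelian Q) -> (forall Q, p.-Sylow(B) Q -> ~~ abelian Q) ->
  p_decomposable p G.
Proof.
move=> nabA nabB; have [_ defG _] := hBaer.
have [P [sylP sylPA sylPB defP]] := Sylow_factorization p defG.
have cPX X : X \subset A :|: B -> ~~ abelian (P :&: X) ->
    forall r h, prime r -> r != p -> h \in G -> r.-elt h -> h \in 'C(P :&: X).
  move=> sXAB nab; apply: baer_centralised_sub => //.
  by apply: contra nab; apply: baer_sub_cent_abelian.
have cP r h : prime r -> r != p -> h \in G -> r.-elt h -> h \in 'C(P).
  move=> r_pr neq_rp Gh rh; rewrite -sub_cent1 -defP mul_subG //= sub_cent1.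
    exact: cPX (subsetUl _ _) (nabA _ sylPA) r h r_pr neq_rp Gh rh.
  exact: cPX (subsetUr _ _) (nabB _ sylPB) r h r_pr neq_rp Gh rh.
exact: p_decomposable_crit sylP (Sylow_normal_crit sylP cP) cP.
Qed.

End BaerFactorisation.

Theorem theorem1 (gT : finGroupType) (p : nat) (G A B P : {group gT})
    (hBaer : p_baer_factorisation p G A B) (hP : p.-Sylow(G) P) :
  (* (1) *)
  p_decomposable p (G / 'C_G('O_p(G)))%G /\
  (* (2) *)
  (P * 'F(G) <| G /\ P * 'O_p^'(G) <| G /\
   p_soluble p G /\ p_length_eq p G 1) /\
  (* (3) *)
  (forall Q : {group coset_of 'F(G)}, p.-Sylow(G / 'F(G)) Q -> abelian Q) /\
  (* (4) *)
  (abelian P <-> abelian 'O_p(G)) /\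
  (* (5) *)
  ((P :&: A) * (P :&: B) = P ->
   forall X : {group gT}, X = A \/ X = B ->
   ~~ (P :&: X \subset 'C_G('O_p(G))) ->
   forall H : {group gT}, p^'.-Hall(G) H -> P :&: X \subset 'C(H)) /\
  (* (6) *)
  ((forall Q : {group gT}, p.-Sylow(A) Q -> ~~ abelian Q) ->
   (forall Q : {group gT}, p.-Sylow(B) Q -> ~~ abelian Q) ->
   p_decomposable p G).
Proof.
have sPG := pHall_sub hP.
split; first exact: baer_quotient_cent_pcore_decomposable hBaer.
split; first split.
- by apply: quotient_normal_mulg; rewrite ?Fitting_normal ?(baer_Fitting_quotient_normal hBaer hP).
- split; last by split; [apply: baer_p_soluble hBaer | apply: baer_p_length1 hBaer].
  by apply: quotient_normal_mulg; rewrite ?pcore_normal ?(baer_p'core_quotient_normal hBaer hP).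
split=> [Q sylQ|].
  have sylPF : p.-Sylow(G / 'F(G)) (P / 'F(G)).
    by rewrite quotient_pHall ?(subset_trans sPG) ?normal_norm ?Fitting_normal.
  have [g _ ->] := Sylow_trans sylPF sylQ.
  by rewrite abelianJ (baer_Sylow_quotient_Fitting_abelian hBaer hP).
split; first by rewrite (baer_Sylow_abelian hBaer hP).
split=> [_ X defX nsPXC H hallH | ]; last exact: baer_nonabelian_decomposable hBaer.
have sXAB : X \subset A :|: B by case: defX => ->; rewrite ?subsetUl ?subsetUr.
rewrite centsC; apply: p'group_cent (pHall_sub hallH) (pHall_pgroup hallH) _.
exact: baer_centralised_sub hBaer P X hP sXAB nsPXC.
Qed.
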